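(* Let $\mathcal{E}$ be a rank $r$ toric vector bundle over $X(\Sigma)$, and suppose that the full flag bundle $\mathcal{FL}(\mathcal{E})$ is a Mori dream space. For each positive integer $\ell$ let $C_\ell\subset \mathrm{CL}(X(\Sigma))_{\mathbb{Q}}\times\mathbb{Q}$ be the pseudo-effective cone of $\mathbb{P}(\mathcal{E}\otimes V)$, where $\dim(V)=\ell$. Then $C_i\subseteq C_j$ when $i<j$, and $C_\ell=C_r$ for all $\ell\ge r$.
   Context: $\mathbb{K}$ is an algebraically closed field; $X(\Sigma)$ is a smooth projective toric variety over $\mathbb{K}$ with torus $T_N$. A toric vector bundle is a vector bundle over $X(\Sigma)$ with a compatible $T_N$-action; $\mathcal{E}\otimes V$ is the tensor product with the trivial bundle with fiber the vector space $V$. The convention is $\mathbb{P}(\mathcal{F})=\mathrm{Proj}\,\mathrm{Sym}(\mathcal{F})$, with projection $\pi:\mathbb{P}(\mathcal{F})\to X(\Sigma)$. The class group of $\mathbb{P}(\mathcal{E}\otimes V)$ is identified with $\mathrm{CL}(X(\Sigma))\times\mathbb{Z}$ by letting $(D,k)$ correspond to $\pi^*\mathcal{O}(D)\otimes\mathcal{O}(k)$, so that the sections are $H^0(X(\Sigma),\mathrm{Sym}^k(\mathcal{E}\otimes V)\otimes\mathcal{O}(D))$; all the cones $C_\ell$ are thus viewed in the common space $\mathrm{CL}(X(\Sigma))_{\mathbb{Q}}\times\mathbb{Q}$. The full flag bundle $\mathcal{FL}(\mathcal{E})$ is the bundle over $X(\Sigma)$ whose fiber over $p$ is the variety of full flags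 in $\mathcal{E}_p^\vee$. A smooth projective variety is a Mori dream space if its Cox ring is finitely generated. *)

(* Defs.v *)
(* MathComp, with multinomials for multivariate polynomials.

   The library has no schemes.  An integral separated scheme over a field is
   represented by its function field together with a family of coordinate rings,
   inside that field, of an open cover (the "models" of Zariski and Samuel,
   Commutative Algebra II, Ch. VI).  Vector bundles and line bundles are
   represented by their sections, inside the fibre at the generic point. *)
From HB Require Import structures.
From mathcomp Require Import all_boot all_order all_algebra.
From mathcomp.multinomials Require Import mpoly.

Set Implicit Arguments.
Unset Strict Implicit.
Unset Printing Implicit Defensive.

Import Order.TTheory GRing.Theory Num.Theory.
Local Open Scope ring_scope.

(* ** Generated subrings, spans, localizations *)

Inductive subring_gen (R : comNzRingType) (S : R -> Prop) : R -> Prop :=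
| subring_gen_base x : S x -> subring_gen S x
| subring_gen_1 : subring_gen S 1
| subring_gen_sub x y : subring_gen S x -> subring_gen S y ->
    subring_gen S (x - y)
| subring_gen_mul x y : subring_gen S x -> subring_gen S y ->
    subring_gen S (x * y).

(* Finite sums of products [a *: s], for [a] in [A] and [s] in [S]. *)
Inductive span_over (R : pzRingType) (V : lmodType R) (A : R -> Prop)
    (S : V -> Prop) : V -> Prop :=
| span_over_0 : span_over A S 0
| span_over_add a s v : A a -> S s -> span_over A S v ->
    span_over A S (a *: s + v).

(* [away A h] is the localization A[1/h] when h is a nonzero element of A. *)
Definition away (F : fieldType) (A : F -> Prop) (h : F) : F -> Prop :=
  fun x => exists N : nat, A (h ^+ N * x).

Record prime_ideal (F : fieldType) (A P : F -> Prop) : Prop := {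
  prime_sub : forall x, P x -> A x;
  prime_0 : P 0;
  prime_add : forall x y, P x -> P y -> P (x + y);
  prime_mul : forall a x, A a -> P x -> P (a * x);
  prime_proper : ~ P 1;
  prime_prime : forall x y, A x -> A y -> P (x * y) -> P x \/ P y
}.

Definition maximal_ideal (F : fieldType) (A P : F -> Prop) : Prop :=
  prime_ideal A P /\
  forall Q, prime_ideal A Q -> (forall x, P x -> Q x) -> forall x, Q x -> P x.

Definition local_ring (F : fieldType) (A P : F -> Prop) : F -> Prop :=
  fun x => exists a s, [/\ A a, A s, ~ P s & x = a / s].

Definition local_ideal (F : fieldType) (A P : F -> Prop) : F -> Prop :=
  fun x => exists a s, [/\ P a, A s, ~ P s & x = a / s].

(* ** Varieties *)

(* [base] is the ground field as a subfield of the function field.  A chart may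
   be any ring whose spectrum is a localization of an open piece; only the local
   rings of the charts matter. *)
Record model := Model {
  ffield : fieldType;
  base : ffield -> Prop;
  chart : (ffield -> Prop) -> Prop
}.

Definition is_local_ring (F : fieldType) (charts : (F -> Prop) -> Prop)
    (B : F -> Prop) : Prop :=
  exists A P, [/\ charts A, prime_ideal A P & forall x, B x <-> local_ring A P x].

(* Projective model (Zariski-Samuel): the local rings are those of the image
   closure of (f_0 : ... : f_q), covered by the charts k[f_0/f_i, ..., f_q/f_i]. *)
Definition projective (Y : model) : Prop :=
  exists (q : nat) (f : 'I_q.+1 -> ffield Y),
    (forall i, f i != 0) /\
    forall B, is_local_ring (@chart Y) B <->
      is_local_ring
        (fun A => exists i,
           A = subring_gen (fun x => base x \/ exists j, x = f j / f i)) B.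

(* The local ring at every closed point is regular of dimension d: its maximal
   ideal has d generators.  To be used for charts of finite type over the ground
   field, with d the dimension. *)
Definition smooth (d : nat) (Y : model) : Prop :=
  forall A P, chart (m := Y) A -> maximal_ideal A P ->
  exists t : 'I_d -> ffield Y,
    (forall i, local_ideal A P (t i)) /\
    forall x, local_ideal A P x ->
      exists c : 'I_d -> ffield Y,
        (forall i, local_ring A P (c i)) /\ x = \sum_i c i * t i.

(* ** Weil divisors and the class group *)

(* Normalized discrete valuations; the value at 0 is a dummy, fixed to be 0. *)
Record discrete_valuation (F : fieldType) (v : F -> int) : Prop := {
  val_0 : v 0 = 0;
  val_mul : forall x y, x != 0 -> y != 0 -> v (x * y) = v x + v y;
  val_add : forall x y, x != 0 -> y != 0 -> x + y != 0 ->
    (v x <= v (x + y)) || (v y <= v (x + y));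
  val_surj : exists2 x, x != 0 & v x = 1
}.

(* The valuation ring is the localization of A at its centre.  On a normal
   variety these are exactly the local rings at the points of codimension 1. *)
Definition prime_divisor_of (F : fieldType) (A : F -> Prop) (v : F -> int) :
    Prop :=
  [/\ discrete_valuation v,
      forall x, A x -> 0 <= v x &
      forall x, 0 <= v x ->
        exists a s, [/\ A a, A s, s != 0, v s = 0 & x = a / s]].

Definition prime_divisor (Y : model) (v : ffield Y -> int) : Prop :=
  exists A, chart A /\ prime_divisor_of A v.

(* Only the values at prime divisors are meaningful. *)
Definition divisor (Y : model) := (ffield Y -> int) -> int.

Definition weil_divisor (Y : model) (D : divisor Y) : Prop :=
  exists (q : nat) (w : 'I_q -> ffield Y -> int),
    forall v, prime_divisor v -> D v != 0 -> exists i, v = w i.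

Definition lin_equiv (Y : model) (D D' : divisor Y) : Prop :=
  exists2 f : ffield Y, f != 0 &
    forall v, prime_divisor v -> D v - D' v = v f.

Definition div_comb (Y : model) (m : nat) (b : 'I_m -> divisor Y)
    (a : 'rV[int]_m) : divisor Y :=
  fun v => \sum_i a 0 i * b i v.

(* The classes of b_1, ..., b_m form a basis of the class group. *)
Definition class_basis (Y : model) (m : nat) (b : 'I_m -> divisor Y) : Prop :=
  (forall i, weil_divisor (b i)) /\
  forall D, weil_divisor D -> exists! a, lin_equiv D (div_comb b a).

(* Sections of O(D) over the chart A. *)
Definition OD (Y : model) (D : divisor Y) (A : ffield Y -> Prop) :
    ffield Y -> Prop :=
  fun f => f = 0 \/ forall v, prime_divisor_of A v -> 0 <= v f + D v.

Definition H0 (Y : model) (D : divisor Y) : ffield Y -> Prop :=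
  fun f => forall A, chart A -> OD D A f.

(* ** Rational function fields and Cox rings *)

Definition ratfun (F : fieldType) (n : nat) : fieldType :=
  {fraction {mpoly F[n]}}.

Definition of_mpoly (F : fieldType) (n : nat) (p : {mpoly F[n]}) : ratfun F n :=
  FracField.tofrac p.

Definition cst (F : fieldType) (n : nat) (c : F) : ratfun F n :=
  of_mpoly (mpolyC n c).

Definition monomial_at (F : fieldType) (n : nat) (x : 'I_n -> F)
    (m : 'rV[int]_n) : F :=
  \prod_i x i ^ m 0 i.

Definition character (F : fieldType) (n : nat) (m : 'rV[int]_n) : ratfun F n :=
  monomial_at (fun i => of_mpoly 'X_i) m.

(* The direct sum over a in Z^m of H^0(Y, O(sum_i a_i b_i)), as the ring of the
   Laurent polynomials sum_a f_a t^a with f_a in the a-th summand. *)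
Definition cox_ring (Y : model) (m : nat) (b : 'I_m -> divisor Y) :
    ratfun (ffield Y) m -> Prop :=
  fun x => exists (q : nat) (a : 'I_q -> 'rV[int]_m) (f : 'I_q -> ffield Y),
    (forall j, H0 (div_comb b (a j)) (f j)) /\
    x = \sum_j cst m (f j) * character (ffield Y) (a j).

(* Since the Cox ring is only formed for a free class group of finite rank, this
   definition is restricted to varieties with such a class group. *)
Definition mori_dream_space (Y : model) : Prop :=
  exists (m : nat) (b : 'I_m -> divisor Y), class_basis b /\
  exists (q : nat) (g : 'I_q -> ratfun (ffield Y) m),
    forall x, cox_ring b x <->
      subring_gen (fun y => (exists2 c, base c & y = cst m c)
                            \/ exists j, y = g j) x.

(* ** Fans and toric varieties; N = M = Z^n *)

(* A cone is given by lattice generators, a fan by the list of its cones.  The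
   cones being rational, their rational points suffice. *)
Definition cone_data (n : nat) := seq 'rV[int]_n.
Definition fan_data (n : nat) := seq (cone_data n).

Definition dot (R : pzRingType) (n : nat) (m x : 'rV[R]_n) : R :=
  \sum_i m 0 i * x 0 i.

Definition in_cone (n : nat) (s : cone_data n) : 'rV[rat]_n -> Prop :=
  span_over (fun c => 0 <= c)
    (fun x => exists2 u, u \in s & x = map_mx intr u).

Definition in_dual (n : nat) (s : cone_data n) (m : 'rV[int]_n) : Prop :=
  forall u, u \in s -> 0 <= dot m u.

Definition in_face (n : nat) (s : cone_data n) (m : 'rV[int]_n)
    (x : 'rV[rat]_n) : Prop :=
  in_cone s x /\ dot (map_mx intr m) x = 0.

Record is_fan (n : nat) (Sigma : fan_data n) : Prop := {
  fan_nonempty : exists s, s \in Sigma;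
  fan_pointed : forall s x, s \in Sigma -> in_cone s x -> in_cone s (- x) ->
    x = 0;
  fan_faces : forall s m, s \in Sigma -> in_dual s m ->
    exists2 t, t \in Sigma & forall x, in_cone t x <-> in_face s m x;
  fan_inter : forall s t, s \in Sigma -> t \in Sigma ->
    exists2 m, in_dual s m &
      forall x, in_face s m x <-> in_cone s x /\ in_cone t x
}.

(* The coordinate ring K[s^vee \cap M] of the affine chart U_s. *)
Definition cone_ring (K : fieldType) (n : nat) (s : cone_data n) :
    ratfun K n -> Prop :=
  fun f => exists (q : nat) (c : 'I_q -> K) (m : 'I_q -> 'rV[int]_n),
    (forall j, in_dual s (m j)) /\
    f = \sum_j cst n (c j) * character K (m j).
Arguments cone_ring K {n} s _.

Definition toric_variety (K : fieldType) (n : nat) (Sigma : fan_data n) :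
    model :=
  @Model (ratfun K n)
    (fun x => exists c, x = cst n c)
    (fun A => exists2 s, s \in Sigma & A = cone_ring K s).

(* ** Toric vector bundles *)

(* E s is the module of sections over U_s, in the fibre at the generic point. *)
Definition sheaf (K : fieldType) (n r : nat) :=
  cone_data n -> 'rV[ratfun K n]_r -> Prop.

(* The rows of g are a frame of E over the open set where h does not vanish. *)
Definition is_frame (K : fieldType) (n r : nat) (E : sheaf K n r)
    (s : cone_data n) (h : ratfun K n) (g : 'M[ratfun K n]_r) : Prop :=
  [/\ cone_ring K s h, h != 0, g \in unitmx &
      forall v, (exists N : nat, E s (h ^+ N *: v)) <->
        exists2 w : 'rV_r, forall i, away (cone_ring K s) h (w 0 i)
                         & v = w *m g].

Record is_vector_bundle (K : fieldType) (n : nat) (Sigma : fan_data n)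
    (r : nat) (E : sheaf K n r) : Prop := {
  vb_0 : forall s, s \in Sigma -> E s 0;
  vb_add : forall s v w, s \in Sigma -> E s v -> E s w -> E s (v + w);
  vb_scale : forall s a v, s \in Sigma -> cone_ring K s a -> E s v ->
    E s (a *: v);
  (* frames exist over a finite cover of U_s by standard open sets *)
  vb_locally_free : forall s, s \in Sigma ->
    exists (q : nat) (a h : 'I_q -> ratfun K n),
      [/\ forall j, cone_ring K s (a j),
          \sum_j a j * h j = 1 &
          forall j, exists g, is_frame E s (h j) g];
  vb_restrict : forall s t, s \in Sigma -> t \in Sigma ->
    (forall x, in_cone t x -> in_cone s x) ->
    forall v, E t v <-> span_over (cone_ring K t) (E s) v
}.

Definition torus_point (K : fieldType) (n : nat) (t : 'rV[K]_n) : Prop :=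
  forall i, t 0 i != 0.

(* Algebraic action of the torus on sections, semilinear with respect to the
   action t . chi^m = chi^m(t) chi^m on functions.  (The geometric action on
   sections is obtained on replacing t by its inverse.)  As K is algebraically
   closed, it is enough to let its K-points act. *)
Record is_torus_action (K : fieldType) (n : nat) (Sigma : fan_data n)
    (r : nat) (E : sheaf K n r)
    (act : 'rV[K]_n -> 'rV[ratfun K n]_r -> 'rV[ratfun K n]_r) : Prop := {
  act_stable : forall s t v, s \in Sigma -> torus_point t -> E s v ->
    E s (act t v);
  act_1 : forall s v, s \in Sigma -> E s v -> act (const_mx 1) v = v;
  act_mul : forall s t u v, s \in Sigma -> torus_point t -> torus_point u ->
    E s v -> act (\row_i (t 0 i * u 0 i)) v = act t (act u v);
  act_add : forall s t v w, s \in Sigma -> torus_point t -> E s v -> E s w ->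
    act t (v + w) = act t v + act t w;
  act_semilinear : forall s t c m v, s \in Sigma -> torus_point t ->
    in_dual s m -> E s v ->
    act t ((cst n c * character K m) *: v)
    = (cst n (c * monomial_at (t 0) m) * character K m) *: act t v;
  act_algebraic : forall s v, s \in Sigma -> E s v ->
    exists (q : nat) (m : 'I_q -> 'rV[int]_n)
           (w : 'I_q -> 'rV[ratfun K n]_r),
      (forall j, E s (w j)) /\
      forall t, torus_point t ->
        act t v = \sum_j cst n (monomial_at (t 0) (m j)) *: w j
}.

Record toric_bundle (K : fieldType) (n : nat) (Sigma : fan_data n) (r : nat) :=
  ToricBundle {
    sections :> sheaf K n r;
    sections_vb : is_vector_bundle Sigma sections;
    torus_act : 'rV[K]_n -> 'rV[ratfun K n]_r -> 'rV[ratfun K n]_r;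
    torus_actP : is_torus_action Sigma sections torus_act
  }.

(* E (x) V for V = K^l, in coordinates: r x l matrices with columns in E. *)
Definition tensor_triv (K : fieldType) (n r : nat) (E : sheaf K n r)
    (l : nat) : sheaf K n (r * l)%N :=
  fun s v => forall a : 'I_l, E s (col a (vec_mx v))^T.
Arguments tensor_triv {K n r} E l s v.

(* ** Full flag bundles *)

Definition below_diag (r : nat) : finType :=
  {p : 'I_r * 'I_r | (p.2 < p.1)%N}.

Definition flag_field (F : fieldType) (r : nat) : fieldType :=
  ratfun F #|below_diag r|.

(* The generic flag in the dual of the generic fibre F^r: its k-th step is
   spanned by the first k columns of the generic lower unitriangular matrix. *)
Definition generic_flag (F : fieldType) (r : nat) : 'M[flag_field F r]_r :=
  \matrix_(i, j)
    (if insub (i, j) is Some p then of_mpoly 'X_(enum_rank (p : below_diag r))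
     else (i == j)%:R).

(* Pluecker coordinate of the k-th step of the generic flag, on the rows f of
   the frame g. *)
Definition pluecker (F : fieldType) (r : nat) (g : 'M[F]_r) (k : 'I_r)
    (f : 'I_k -> 'I_r) : flag_field F r :=
  \det (mxsub f (widen_ord (ltnW (ltn_ord k)))
          (map_mx (cst #|below_diag r|) g *m generic_flag F r)).

(* The flags in the fibres of the dual of E over the standard open sets over
   which E has a frame, in their Pluecker embedding in the product of the
   P(Lambda^k), k < r; the charts are those where, for all k, the J_k-th
   Pluecker coordinate is invertible. *)
Definition flag_bundle (K : fieldType) (n : nat) (Sigma : fan_data n) (r : nat)
    (E : sheaf K n r) : model :=
  @Model (flag_field (ratfun K n) r)
    (fun x => exists c : K, x = cst _ (cst n c))
    (fun A => exists s h g (J : forall k : 'I_r, 'I_k -> 'I_r),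
       [/\ s \in Sigma, is_frame E s h g, forall k, injective (J k) &
           A = subring_gen (fun x =>
             (exists2 a, away (cone_ring K s) h a & x = cst _ a) \/
             exists (k : 'I_r) (f : 'I_k -> 'I_r),
               x = pluecker g f / pluecker g (J k))]).

(* ** Projective bundles *)

Definition linear_form (F : fieldType) (N : nat) (v : 'rV[F]_N) :
    {mpoly F[N]} :=
  \sum_i v 0 i *: 'X_i.

(* The sections of O(D) (x) Sym^d B over U_s. *)
Definition sym_twist (K : fieldType) (n : nat) (Sigma : fan_data n) (N : nat)
    (B : sheaf K n N) (D : divisor (toric_variety K Sigma)) (d : nat)
    (s : cone_data n) : {mpoly (ratfun K n)[N]} -> Prop :=
  span_over (OD D (cone_ring K s))
    (fun p => exists2 w : 'I_d -> 'rV_N, forall j, B s (w j)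
                                       & p = \prod_j linear_form (w j)).

(* Global sections of pi^*O(D) (x) O(k) on P(B) = Proj Sym B: elements of degree
   k of the localization of the graded module O(D) (x) Sym B at every nonzero
   element of degree 1, over every U_s. *)
Definition H0_proj (K : fieldType) (n : nat) (Sigma : fan_data n) (N : nat)
    (B : sheaf K n N) (D : divisor (toric_variety K Sigma)) (k : nat) :
    ratfun (ratfun K n) N -> Prop :=
  fun x => forall s w, s \in Sigma -> B s w -> w != 0 ->
    exists (e : nat) (p : {mpoly (ratfun K n)[N]}),
      sym_twist B D (k + e)%N s p /\
      x * of_mpoly (linear_form w ^+ e) = of_mpoly p.

(* The pseudo-effective cone of P(E (x) K^l) in CL(X)_Q x Q, where CL(X)_Q is
   identified with Q^m by a basis b of CL(X), which is free: the closure of the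
   cone generated by the pairs (D, k) for which pi^*O(D) (x) O(k) has a nonzero
   section.  There is none for k < 0 when the rank of E (x) K^l is at least 2.
   When the rank is 1, P(E (x) K^l) = X and CL(X) x Z is not its class group;
   requiring k >= 0 then agrees with the sections for (D, k) being those of
   Sym^k(E (x) K^l) (x) O(D). *)
Definition effective_class (K : fieldType) (n : nat) (Sigma : fan_data n)
    (r : nat) (E : sheaf K n r) (m : nat)
    (b : 'I_m -> divisor (toric_variety K Sigma)) (l : nat)
    (x : 'rV[rat]_m * rat^o) : Prop :=
  exists (a : 'rV[int]_m) (k : nat),
    x = (map_mx intr a, k%:R) /\
    exists2 g, g != 0 & H0_proj (tensor_triv E l) (div_comb b a) k g.

Definition pseudo_effective (K : fieldType) (n : nat) (Sigma : fan_data n)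
    (r : nat) (E : sheaf K n r) (m : nat)
    (b : 'I_m -> divisor (toric_variety K Sigma)) (l : nat)
    (x : 'rV[rat]_m * rat^o) : Prop :=
  forall eps : rat, 0 < eps ->
  exists y : 'rV[rat]_m * rat^o,
    [/\ span_over (fun c => 0 <= c) (effective_class E b l) y,
        forall i, `|x.1 0 i - y.1 0 i| < eps &
        `|(x.2 : rat) - y.2| < eps].

(* Main.v *)
(* A section of O(k) on P(E (x) V) is a polynomial P of degree k on
   Hom(V, E^vee) over X.  Over the generic point, P is a nonzero polynomial in
   the entries of an r x l matrix; since K is infinite, P does not vanish at some
   matrix Y with entries in K.  A linear map phi of the trivial bundles carries P
   to a section for P(E (x) V'), which is nonzero at Z as soon as Z *m phi = Y.
   Such Z and phi exist when dim V' >= dim V (phi a projection), and when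
   dim V' = r (Z = 1, phi = Y).  So the inclusions already hold for the sets of
   effective classes. *)
From HB Require Import structures.
Require Import Defs.
From mathcomp Require Import all_boot all_order all_algebra.
From mathcomp.multinomials Require Import mpoly.

Set Implicit Arguments.
Unset Strict Implicit.
Unset Printing Implicit Defensive.

Import Order.TTheory GRing.Theory Num.Theory.
Local Open Scope ring_scope.

(** * Submodules, spans and localization *)

Definition semiring_pred (R : pzRingType) (A : R -> Prop) : Prop :=
  [/\ A 0, A 1, forall x y, A x -> A y -> A (x + y)
    & forall x y, A x -> A y -> A (x * y)].

Definition submodule (R : pzRingType) (V : lmodType R) (A : R -> Prop)
    (M : V -> Prop) : Prop :=
  [/\ M 0, forall u v, M u -> M v -> M (u + v)
    & forall a u, A a -> M u -> M (a *: u)].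

Definition away_mod (F : fieldType) (V : lmodType F) (M : V -> Prop) (h : F) :
    V -> Prop :=
  fun v => exists N : nat, M (h ^+ N *: v).

Lemma span_over_sub (R : pzRingType) (V : lmodType R) (A : R -> Prop)
    (S M : V -> Prop) :
  M 0 -> (forall u v, M u -> M v -> M (u + v)) ->
  (forall a s, A a -> S s -> M (a *: s)) ->
  forall v, span_over A S v -> M v.
Proof.
move=> M0 MD MZ v; elim=> // a s w Aa Ss _ Mw.
by apply: MD => //; apply: MZ.
Qed.

Lemma span_over_base (R : pzRingType) (V : lmodType R) (A : R -> Prop)
    (S : V -> Prop) a s :
  A a -> S s -> span_over A S (a *: s).
Proof.
by move=> Aa Ss; rewrite -[_ *: _]addr0; apply: span_over_add => //;
   apply: span_over_0.
Qed.

Lemma span_over_mono (R : pzRingType) (V : lmodType R) (A : R -> Prop)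
    (S S' : V -> Prop) :
  (forall v, S v -> S' v) -> forall v, span_over A S v -> span_over A S' v.
Proof.
move=> sub v; elim=> [|a s w Aa Ss _ IH]; first exact: span_over_0.
by apply: span_over_add => //; apply: sub.
Qed.

(** The coefficients form an A-module [L], later the sections of O(D), rather than a ring: scalars
    from [A] are absorbed into the coefficients. *)
Lemma span_over_submodule (R : pzRingType) (V : lmodType R) (A L : R -> Prop)
    (S : V -> Prop) :
  submodule A (L : R^o -> Prop) -> submodule A (span_over L S).
Proof.
move=> [L0 LD LZ]; split; first exact: span_over_0.
- move=> u v Su Sv; elim: Su => [|a s w La Ss _ IH]; first by rewrite add0r.
  by rewrite -addrA; apply: span_over_add.
- move=> a u Aa; elim=> [|b s w Lb Ss _ IH].
    by rewrite scaler0; apply: span_over_0.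
  by rewrite scalerDr scalerA; apply: span_over_add => //; apply: LZ.
Qed.

Lemma submodule_sum (R : pzRingType) (V : lmodType R) (A : R -> Prop)
    (M : V -> Prop) (I : eqType) (s : seq I) (P : pred I) (f : I -> V) :
  submodule A M -> (forall i, i \in s -> P i -> M (f i)) ->
  M (\sum_(i <- s | P i) f i).
Proof.
move=> [M0 MD _] Mf; rewrite big_seq_cond; apply: big_ind => //.
by move=> i /andP[]; apply: Mf.
Qed.

Lemma semiring_exp (R : pzRingType) (A : R -> Prop) x k :
  semiring_pred A -> A x -> A (x ^+ k).
Proof.
by move=> [_ A1 _ AM] Ax; elim: k => // k IH; rewrite exprS; apply: AM.
Qed.

Lemma submodule_clear_denominators (F : fieldType) (V : lmodType F)
    (A : F -> Prop) (M : V -> Prop) h N N' v :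
  semiring_pred A -> submodule A M -> A h -> (N <= N')%N ->
  M (h ^+ N *: v) -> M (h ^+ N' *: v).
Proof.
move=> sA [_ _ MZ] Ah le_N Mv; rewrite -(subnK le_N) exprD -scalerA.
by apply: MZ => //; apply: semiring_exp.
Qed.

Lemma away_submodule (F : fieldType) (V : lmodType F) (A : F -> Prop)
    (M : V -> Prop) h :
  semiring_pred A -> submodule A M -> A h ->
  submodule (away A h) (away_mod M h).
Proof.
move=> sA sM Ah; have [M0 MD MZ] := sM; split.
- by exists 0%N; rewrite scaler0.
- move=> u v [Nu Mu] [Nv Mv]; exists (maxn Nu Nv); rewrite scalerDr.
  apply: MD.
    exact: (submodule_clear_denominators sA sM Ah (leq_maxl _ _) Mu).
  exact: (submodule_clear_denominators sA sM Ah (leq_maxr _ _) Mv).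
- move=> a u [Na Aa] [Nu Mu]; exists (Na + Nu)%N.
  by rewrite exprD scalerA mulrAC -scalerA; apply: MZ.
Qed.

(* Partition of unity: the elements of A with a power in the ideal
   {c | c *: v in M} form an ideal. *)
Lemma submodule_glue (F : fieldType) (V : lmodType F) (A : F -> Prop)
    (M : V -> Prop) (q : nat) (a h : 'I_q -> F) v :
  semiring_pred A -> submodule A M ->
  (forall j, A (a j)) -> (forall j, A (h j)) -> \sum_j a j * h j = 1 ->
  (forall j, away_mod M (h j) v) -> M v.
Proof.
move=> sA sM Aa Ah ah1 Mh; have [A0 A1 AD AM] := sA; have [M0 MD MZ] := sM.
pose rad c := A c /\ exists N, M (c ^+ N *: v).
suff [_ [N]] : rad 1 by rewrite expr1n scale1r.
rewrite -ah1; apply: big_ind => [|x y [Ax [Nx Mx]] [Ay [Ny My]]|j _].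
- by split=> //; exists 1%N; rewrite expr1 scale0r.
- split; first exact: AD.
  (* In each term of the binomial expansion, either the exponent of x is at least [Nx] or that of y
     is at least [Ny]. *)
  exists (Nx + Ny)%N; rewrite exprDn scaler_suml.
  apply: (submodule_sum sM) => i _ _.
  rewrite -mulr_natr mulrC.
  have An : A ('C(Nx + Ny, i)%:R).
    by elim: 'C(_, _) => // k IH; rewrite -natr1; apply: AD.
  rewrite -scalerA; apply: (MZ) => //; have [le_i|lt_i] := leqP i Ny.
    rewrite mulrC -scalerA; apply: (MZ); first exact: semiring_exp.
    apply: (submodule_clear_denominators sA sM Ax _ Mx).
    by rewrite leq_subRL ?(leq_trans le_i) ?leq_addl // addnC leq_add2l.
  rewrite -scalerA; apply: (MZ); first exact: semiring_exp.
  exact: (submodule_clear_denominators sA sM Ay (ltnW lt_i) My).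
- split; first exact: AM.
  have [N MN] := Mh j; exists N; rewrite exprMn -scalerA.
  by apply: (MZ) => //; apply: semiring_exp.
Qed.

(** * Linear forms *)

Lemma linear_formD (F : fieldType) (N : nat) (u v : 'rV[F]_N) :
  linear_form (u + v) = linear_form u + linear_form v.
Proof.
rewrite /linear_form -big_split /=; apply: eq_bigr => i _.
by rewrite mxE scalerDl.
Qed.

Lemma linear_formZ (F : fieldType) (N : nat) a (v : 'rV[F]_N) :
  linear_form (a *: v) = a *: linear_form v.
Proof.
by rewrite /linear_form scaler_sumr; apply: eq_bigr => i _; rewrite mxE scalerA.
Qed.

Lemma linear_form_sum (F : fieldType) (N : nat) (I : Type) (s : seq I)
    (P : pred I) (f : I -> 'rV[F]_N) :
  linear_form (\sum_(i <- s | P i) f i) = \sum_(i <- s | P i) linear_form (f i).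
Proof.
apply: big_morph => [u v|]; first exact: linear_formD.
by rewrite -(scale0r 0) linear_formZ scale0r.
Qed.

(** The map Sym(M) induced on symmetric algebras by v |-> v M on row vectors. *)
Definition linear_subst (F : fieldType) (N N' : nat) (M : 'M[F]_(N, N')) :
    {mpoly F[N]} -> {mpoly F[N']} :=
  comp_mpoly [tuple linear_form (row i M) | i < N].

HB.instance Definition _ (F : fieldType) (N N' : nat) (M : 'M[F]_(N, N')) :=
  GRing.LRMorphism.on (linear_subst M).

Lemma linear_substX (F : fieldType) (N N' : nat) (M : 'M[F]_(N, N')) i :
  linear_subst M 'X_i = linear_form (row i M).
Proof. by rewrite /linear_subst comp_mpolyXU -tnth_nth tnth_mktuple. Qed.

Lemma linear_subst_form (F : fieldType) (N N' : nat) (M : 'M[F]_(N, N')) v :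
  linear_subst M (linear_form v) = linear_form (v *m M).
Proof.
rewrite mulmx_sum_row linear_form_sum [linear_form v]/linear_form.
rewrite raddf_sum /=; apply: eq_bigr => i _.
by rewrite linearZ /= linear_substX linear_formZ.
Qed.

Lemma linear_subst_comp (F : fieldType) (N N' N'' : nat) (M : 'M[F]_(N, N'))
    (M' : 'M[F]_(N', N'')) p :
  linear_subst M' (linear_subst M p) = linear_subst (M *m M') p.
Proof.
elim/mpolyind: p => [|c m p _ _ IH]; first by rewrite !raddf0.
rewrite !raddfD /= IH; congr (_ + _).
rewrite !linearZ /= mpolyXE_id !rmorph_prod; congr (_ *: _).
apply: eq_bigr => i _; rewrite !rmorphXn /= !linear_substX linear_subst_form.
by rewrite row_mul.
Qed.

Lemma linear_subst1 (F : fieldType) (N : nat) (p : {mpoly F[N]}) :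
  linear_subst 1%:M p = p.
Proof.
rewrite -[RHS]comp_mpoly_id /linear_subst; congr comp_mpoly.
apply: eq_from_tnth => i; rewrite !tnth_mktuple /linear_form.
rewrite (bigD1 i) //= !mxE eqxx scale1r big1 ?addr0 // => j ne_ji.
by rewrite !mxE eq_sym (negbTE ne_ji) scale0r.
Qed.

(** Sections are rows and points are columns: Sym(M) is the pullback of functions along z |-> M
    z. *)
Lemma linear_subst_meval (F : fieldType) (N N' : nat) (M : 'M[F]_(N, N')) p
    (z : 'cV[F]_N') :
  (linear_subst M p).@[fun j => z j 0] = p.@[fun i => (M *m z) i 0].
Proof.
rewrite /linear_subst comp_mpoly_meval; apply: meval_eq => i.
rewrite tnth_mktuple /linear_form raddf_sum mxE /=.
by apply: eq_bigr => j _; rewrite mevalZ mevalXU mxE.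
Qed.

(** * Symmetric powers in a frame *)

(** The generators used in [sym_twist], isolated so that the coefficient module can be varied. *)
Definition sym_prod (F : fieldType) (N : nat) (B : 'rV[F]_N -> Prop) (d : nat) :
    {mpoly F[N]} -> Prop :=
  fun p => exists2 w : 'I_d -> 'rV_N, forall j, B (w j)
                                    & p = \prod_j linear_form (w j).

Definition monomial_of_degree (F : fieldType) (N d : nat) :
    {mpoly F[N]} -> Prop :=
  fun p => exists2 m, mdeg m = d & p = 'X_[m].
Arguments monomial_of_degree F N d _ : clear implicits.

(** The last two conditions are the two inclusions between B_h and the A_h-span of the rows of [g],
    the first of them written in coordinates. *)
Definition local_frame (F : fieldType) (N : nat) (A : F -> Prop)
    (B : 'rV[F]_N -> Prop) (h : F) (g : 'M[F]_N) : Prop :=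
  [/\ A h, h != 0, g \in unitmx,
      forall v, B v -> forall i, away A h ((v *m invmx g) 0 i)
    & forall i, away_mod B h (row i g)].

(** Membership becomes a condition on each coefficient separately, so that it can be transported
    along multiplication by a monomial. *)
Lemma span_monomialE (F : fieldType) (N : nat) (A L : F -> Prop) d
    (p : {mpoly F[N]}) :
  submodule A (L : F^o -> Prop) ->
  span_over L (monomial_of_degree F N d) p <->
  forall m, L p@_m /\ (p@_m != 0 -> mdeg m = d).
Proof.
move=> sL; have [L0 LD _] := sL; split.
  move: p; apply: span_over_sub => [m|p q Hp Hq m|a _ La [k <- ->] m].
  - by rewrite mcoeff0 eqxx.
  - have [Lp dp] := Hp m; have [Lq dq] := Hq m.
    rewrite mcoeffD; split; first exact: LD.
    have [->|/dp //] := eqVneq p@_m 0.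
    by rewrite add0r => /dq.
  - rewrite mcoeffZ mcoeffX; case: eqVneq => [->|_]; first by rewrite mulr1.
    by rewrite mulr0 eqxx.
move=> Hp; rewrite [p]mpolyE.
apply: (submodule_sum (span_over_submodule _ sL)) => m m_p _.
have [Lpm degm] := Hp m; apply: span_over_base => //.
by exists m => //; apply: degm; rewrite mcoeff_eq0 negbK.
Qed.

Lemma span_monomial_prod (F : fieldType) (N : nat) (A L : F -> Prop) d
    (u : 'I_d -> 'rV[F]_N) a :
  submodule A (L : F^o -> Prop) -> (forall j i, A (u j 0 i)) -> L a ->
  span_over L (monomial_of_degree F N d) (a *: \prod_j linear_form (u j)).
Proof.
move=> sL Au La; elim: d u Au => [|d IH] u Au.
  rewrite big_ord0; apply: span_over_base => //.
  by exists 0%MM; rewrite ?mdeg0 ?mpolyX0.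
rewrite big_ord_recr /= scalerAl /linear_form mulr_sumr.
apply: (submodule_sum (span_over_submodule _ sL)) => i _ _.
rewrite -scalerAr.
have [_ _ SZ] := span_over_submodule (monomial_of_degree F N d.+1) sL.
apply: SZ; first exact: Au.
have {IH} := IH (fun j => u (widen_ord (leqnSn d) j)) (fun j => Au _).
move: (_ *: \prod_(_ < d) _) => p.
elim=> [|c s q Lc [m md ->] _ IH]; first by rewrite mul0r; apply: span_over_0.
rewrite mulrDl -scalerAl -mpolyXD; apply: span_over_add => //.
by exists (m + U_(i))%MM; rewrite // mdegD mdeg1 md addn1.
Qed.

(** Together with [coord_sym]: in the coordinates of a frame, the localization at h of L (x) Sym^d B
    consists of the homogeneous polynomials of degree d with coefficients in L_h. *)
Lemma sym_coord (F : fieldType) (N : nat) (A L : F -> Prop)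
    (B : 'rV[F]_N -> Prop) h g d p :
  semiring_pred A -> submodule A (L : F^o -> Prop) -> local_frame A B h g ->
  span_over L (sym_prod B d) p ->
  span_over (away L h) (monomial_of_degree F N d) (linear_subst (invmx g) p).
Proof.
move=> sA sL [Ah _ _ Bg _].
have sL' := away_submodule sA sL Ah.
have [S0 SD _] := span_over_submodule (monomial_of_degree F N d) sL'.
move: p; apply: span_over_sub => [|p q Sp Sq|a _ La [w Bw ->]].
- by rewrite raddf0.
- by rewrite raddfD; apply: SD.
- rewrite linearZ rmorph_prod /=.
  under eq_bigr => j _ do rewrite linear_subst_form.
  apply: (span_monomial_prod sL'); last by exists 0%N; rewrite scale1r.
  by move=> j i; apply: Bg.
Qed.

Lemma sym_prodM (F : fieldType) (N : nat) (B : 'rV[F]_N -> Prop) d d' p p' :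
  sym_prod B d p -> sym_prod B d' p' -> sym_prod B (d + d') (p * p').
Proof.
move=> [w Bw ->] [w' Bw' ->].
exists (fun j => match split j with inl i => w i | inr i => w' i end).
  by move=> j; case: split.
rewrite big_split_ord; congr (_ * _); apply: eq_bigr => i _.
  by rewrite -[lshift _ _]/(unsplit (inl i)) unsplitK.
by rewrite -[rshift _ _]/(unsplit (inr i)) unsplitK.
Qed.

Lemma coord_sym (F : fieldType) (N : nat) (A L : F -> Prop)
    (B : 'rV[F]_N -> Prop) h g d q :
  semiring_pred A -> submodule A (L : F^o -> Prop) -> local_frame A B h g ->
  span_over (away L h) (monomial_of_degree F N d) q ->
  away_mod (span_over L (sym_prod B d)) h (linear_subst g q).
Proof.
move=> sA sL [Ah _ _ _ Bg].
have sS := span_over_submodule (sym_prod B d) sL.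
have [S0 SD _] := away_submodule sA sS Ah.
move: q; apply: span_over_sub => [|p q Sp Sq|a _ [M La] [m <- ->]].
- by rewrite raddf0.
- by rewrite raddfD; apply: SD.
(* [T e p] says that p is a product of e sections of B up to a power of h. Degrees and powers of h
   add up under products, so it is enough to treat each variable, whose image is a row of g. *)
pose T e (p : {mpoly F[N]}) := exists M, sym_prod B e (h ^+ M *: p).
have T1 : T 0%N 1.
  exists 0%N; rewrite scale1r; exists (fun=> 0); first by case.
  by rewrite big_ord0.
have TM e e' p p' : T e p -> T e' p' -> T (e + e')%N (p * p').
  move=> [M1 T1p] [M2 T2p]; exists (M1 + M2)%N.
  by rewrite exprD -scalerA scalerAr scalerAl; apply: sym_prodM.
have [M' Tm] : T (mdeg m) (linear_subst g 'X_[m]).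
  rewrite mpolyXE_id rmorph_prod /= mdegE.
  apply: (big_ind2 T) => // [e p e' p'|i _]; first exact: TM.
  rewrite rmorphXn /= linear_substX.
  have [M' BM'] := Bg i; elim: (m i) => // k IH.
  rewrite exprS -add1n; apply: TM => //; exists M'.
  exists (fun=> h ^+ M' *: row i g) => //.
  by rewrite big_ord1 linear_formZ.
exists (M + M')%N; rewrite linearZ scalerA exprD mulrAC -scalerA.
exact: span_over_base.
Qed.

Lemma monomial_factor (F : fieldType) (N : nat) (p : {mpoly F[N]}) k :
  (forall m, m \in msupp p -> (k <= m)%MM) -> exists q, p = q * 'X_[k].
Proof.
move=> le_k; exists (\sum_(m <- msupp p) p@_m *: 'X_[(m - k)%MM]).
rewrite {1}[p]mpolyE mulr_suml; apply: eq_big_seq => m /le_k le_km.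
by rewrite -scalerAl -mpolyXD submK.
Qed.

Lemma monomial_dvd_mul (F : fieldType) (N : nat) (p : {mpoly F[N]}) k m :
  m \in msupp (p * 'X_[k]) -> (k <= m)%MM.
Proof.
rewrite (perm_mem (msuppMX _ _)) => /mapP[m' _ ->].
by apply/mnm_lepP => i; rewrite mnmDE leq_addr.
Qed.

(** * Sections of O(k) on Proj Sym B *)

(** [H0_proj] over a single chart, with a module [L] in the place of the sections of O(D). *)
Definition proj_section (F : fieldType) (N : nat) (L : F -> Prop)
    (B : 'rV[F]_N -> Prop) (k : nat) (x : ratfun F N) : Prop :=
  forall w, B w -> w != 0 -> exists e (p : {mpoly F[N]}),
    span_over L (sym_prod B (k + e)%N) p /\
    x * of_mpoly (linear_form w ^+ e) = of_mpoly p.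

Lemma linear_substK (F : fieldType) (N : nat) (g : 'M[F]_N) p :
  g \in unitmx -> linear_subst g (linear_subst (invmx g) p) = p.
Proof. by move=> ug; rewrite linear_subst_comp mulVmx // linear_subst1. Qed.

Lemma linear_substVK (F : fieldType) (N : nat) (g : 'M[F]_N) p :
  g \in unitmx -> linear_subst (invmx g) (linear_subst g p) = p.
Proof. by move=> ug; rewrite linear_subst_comp mulmxV // linear_subst1. Qed.

(** The defining condition is applied to w = h^M (row i of g), a nonzero element of B for M large;
    in coordinates, its linear form is h^M X_i. *)
Lemma proj_section_coord (F : fieldType) (N : nat) (A L : F -> Prop)
    (B : 'rV[F]_N -> Prop) k x h g i :
  semiring_pred A -> submodule A (L : F^o -> Prop) -> local_frame A B h g ->
  proj_section L B k x ->
  exists e M (q : {mpoly F[N]}),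
    span_over (away L h) (monomial_of_degree F N (k + e)) q /\
    x * of_mpoly (linear_subst g (h ^+ M *: 'X_[U_(i) *+ e]))
    = of_mpoly (linear_subst g q).
Proof.
move=> sA sL fr Hx; have [Ah h0 ug _ Bg] := fr; have [M BM] := Bg i.
have [|e [p [Sp xp]]] := Hx _ BM.
  rewrite scaler_eq0 expf_eq0 (negbTE h0) andbF /=.
  apply/eqP => /(congr1 (mulmx^~ (invmx g))) /=.
  rewrite rowE mulmxK // mul0mx => /rowP/(_ i)/eqP.
  by rewrite !mxE !eqxx oner_eq0.
exists e, (M * e)%N, (linear_subst (invmx g) p); split.
  exact: sym_coord sL fr Sp.
rewrite linear_substK // -xp linear_formZ exprZn -exprM linearZ /=.
by rewrite -mpolyXn rmorphXn /= linear_substX.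
Qed.

(** Up to powers of h, x is both q / X_0^e and q1 / X_1^e1 in the coordinates of the frame.
    Cross-multiplying, X_0^e divides q X_1^e1, hence q, because X_0 does not occur in X_1^e1. *)
Lemma proj_section_poly (F : fieldType) (N : nat) (A L : F -> Prop)
    (B : 'rV[F]_N -> Prop) k x h g :
  (0 < N)%N ->
  semiring_pred A -> submodule A (L : F^o -> Prop) -> local_frame A B h g ->
  proj_section L B k x -> exists P, x = of_mpoly P.
Proof.
move=> N0 sA sL fr Hx; have [Ah h0 ug _ _] := fr.
have sL' := away_submodule sA sL Ah.
pose i0 := Ordinal N0.
have [e [M [q [Sq xq]]]] := proj_section_coord i0 sA sL fr Hx.
have hM0 M' : h ^+ M' != 0 by rewrite expf_neq0.
have Xg0 M' m : linear_subst g (h ^+ M' *: 'X_[m]) != 0.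
  apply/eqP => /(congr1 (linear_subst (invmx g))).
  rewrite linear_substVK // raddf0 => /mpolyP/(_ m)/eqP.
  by rewrite mcoeffZ mcoeffX eqxx mulr1 mcoeff0 (negbTE (hM0 _)).
have [q' def_q] : exists q', q = q' * 'X_[U_(i0) *+ e].
  apply: monomial_factor => m m_q.
  suff le_e : (e <= m i0)%N.
    apply/mnm_lepP => i; rewrite mulmnE mnm1E.
    by case: eqVneq => [<-|_]; rewrite ?mul1n ?mul0n.
  have deg_m : mdeg m = (k + e)%N.
    have [_] := (proj1 (span_monomialE (k + e) q sL') Sq) m.
    by apply; rewrite -mcoeff_msupp.
  (* With a single variable there is no X_1 to compare with, but homogeneity of degree k + e already
     gives X_0 an exponent of at least e, as k >= 0. *)
  have [N1|] := leqP N 1.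
    rewrite mdegE (bigD1 i0) //= big1 ?addn0 in deg_m.
      by rewrite deg_m leq_addl.
    move=> i /eqP[]; apply: val_inj; have := leq_trans (ltn_ord i) N1.
    by rewrite ltnS leqn0 => /eqP.
  move=> N1; pose i1 := Ordinal N1.
  have [e1 [M1 [q1 [_ xq1]]]] := proj_section_coord i1 sA sL fr Hx.
  have qq1 : q * (h ^+ M1 *: 'X_[U_(i1) *+ e1])
             = (h ^+ M *: q1) * 'X_[U_(i0) *+ e].
    rewrite -scalerAl scalerAr; apply: (can_inj (fun p => linear_substVK p ug)).
    apply/eqP; rewrite !rmorphM -tofrac_eq !tofracM.
    rewrite -![FracField.tofrac _]/(of_mpoly _) -xq -xq1.
    by rewrite mulrAC.
  (* Multiplying by X_1^e1 leaves the exponent of X_0 in m unchanged. *)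
  have : (U_(i1) *+ e1 + m)%MM \in msupp ((h ^+ M *: q1) * 'X_[U_(i0) *+ e]).
    rewrite -qq1 mcoeff_msupp -scalerAr mcoeffZ mcoeffMX mulf_neq0 //.
    by rewrite -mcoeff_msupp.
  move/monomial_dvd_mul/mnm_lepP/(_ i0).
  by rewrite mnmDE !mulmnE !mnm1E eqxx mul1n.
exists ((h ^+ M)^-1 *: linear_subst g q').
have Xg0' : of_mpoly (linear_subst g (h ^+ M *: 'X_[U_(i0) *+ e])) != 0.
  by rewrite tofrac_eq0.
apply: (mulIf Xg0'); rewrite xq def_q -tofracM; congr of_mpoly.
by rewrite linearZ /= -scalerAr -scalerAl scalerA mulfV // scale1r rmorphM.
Qed.

(** Once x is a polynomial, one variable is enough: q is h^M X_0^e times P in coordinates, so the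
    coefficients of P are those of q shifted by X_0^e and divided by h^M, and the degree drops from
    k + e to k. *)
Lemma proj_section_away (F : fieldType) (N : nat) (A L : F -> Prop)
    (B : 'rV[F]_N -> Prop) k P h g :
  (0 < N)%N ->
  semiring_pred A -> submodule A (L : F^o -> Prop) -> local_frame A B h g ->
  proj_section L B k (of_mpoly P) ->
  away_mod (span_over L (sym_prod B k)) h P.
Proof.
move=> N0 sA sL fr Hx; have [Ah h0 ug _ _] := fr.
have sL' := away_submodule sA sL Ah.
have [e [M [q [Sq xq]]]] := proj_section_coord (Ordinal N0) sA sL fr Hx.
rewrite -(linear_substK P ug); apply: (coord_sym sA sL fr).
set P' := linear_subst _ P.
have def_q : q = h ^+ M *: (P' * 'X_[U_(Ordinal N0) *+ e]).
  rewrite scalerAr; apply: (can_inj (fun p => linear_substVK p ug)).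
  apply/eqP; rewrite rmorphM /= linear_substK // -tofrac_eq tofracM.
  by apply/eqP; symmetry.
apply/(span_monomialE _ _ sL') => m.
have [] := proj1 (span_monomialE (k + e) q sL') Sq (U_(Ordinal N0) *+ e + m)%MM.
rewrite def_q mcoeffZ mcoeffMX => -[M' LP] deg_m; split.
  by exists (M' + M)%N; rewrite exprD -scalerA.
move=> Pm0; have := deg_m (mulf_neq0 (expf_neq0 M h0) Pm0).
by rewrite mdegD mdegMn mdeg1 mul1n addnC => /addIn.
Qed.

(** * Points over an infinite subfield *)

Lemma closed_field_uniq_seq (K : closedFieldType) (q : nat) :
  exists2 s : seq K, uniq s & size s = q.
Proof.
elim: q => [|q [s us <-]]; first by exists [::].
have /closed_nonrootP[x] : \prod_(a <- s) ('X - a%:P) != 0 :> {poly K}.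
  by apply: monic_neq0; apply: monic_prod_XsubC.
by rewrite root_prod_XsubC => x_s; exists (x :: s); rewrite //= x_s.
Qed.

(** The coefficients may lie in the larger field [F]: there are fewer than [size p] roots there,
    while K supplies [size p] distinct candidates. *)
Lemma poly_nonroot (K : closedFieldType) (F : fieldType)
    (iota : {rmorphism K -> F}) (p : {poly F}) :
  p != 0 -> exists x, p.[iota x] != 0.
Proof.
move=> p0; have [s us sz] := closed_field_uniq_seq K (size p).
have : ~~ all (root p) (map iota s).
  apply: contraTN (leqnn (size p)) => all_p.
  rewrite -ltnNge -[X in (X < _)%N]sz -(size_map iota).
  apply: max_poly_roots => //.
  by rewrite map_inj_uniq //; apply: fmorph_inj.
by case/allPn => _ /mapP[x _ ->] px; exists x.
Qed.

Lemma base_expansion_inj (q b : nat) (m m' : 'I_q -> nat) :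
  (forall i, (m i < b)%N) -> (forall i, (m' i < b)%N) ->
  (\sum_i m i * b ^ i = \sum_i m' i * b ^ i)%N -> m =1 m'.
Proof.
elim: q m m' => [|q IH] m m' lt_m lt_m'; first by move=> _ [].
rewrite !big_ord_recl !expn0 !muln1.
pose tl (f : 'I_q.+1 -> nat) := (\sum_(i < q) f (lift ord0 i) * b ^ i)%N.
have tlE f : (\sum_(i < q) f (lift ord0 i) * b ^ lift ord0 i = tl f * b)%N.
  by rewrite big_distrl; apply: eq_bigr => i _ /=; rewrite -mulnA -expnSr.
rewrite !tlE => eq_mm'.
(* Reduction modulo b isolates the lowest digit. *)
have eq0 : m ord0 = m' ord0.
  have := congr1 (modn^~ b) eq_mm'.
  by rewrite /= ![(_ + _ * b)%N]addnC !modnMDl !modn_small.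
have b_gt0 : (0 < b)%N by apply: leq_ltn_trans (lt_m ord0).
move: eq_mm'; rewrite eq0 => /addnI/eqP; rewrite eqn_pmul2r // => /eqP eq_tl.
move=> i; case: (unliftP ord0 i) => [j ->|-> //].
by apply: (IH (fun j => m (lift ord0 j)) (fun j => m' (lift ord0 j))).
Qed.

(* Kronecker substitution: X_i := t ^ (b ^ i), with b larger than the degree,
   separates the monomials of p. *)
Lemma mpoly_nonroot (K : closedFieldType) (F : fieldType)
    (iota : {rmorphism K -> F}) (N : nat) (p : {mpoly F[N]}) :
  p != 0 -> exists x : 'I_N -> K, p.@[fun i => iota (x i)] != 0.
Proof.
move=> p0; pose b := (msize p).+1.
pose code (m : 'X_{1..N}) := (\sum_i m i * b ^ i)%N.
pose P : {poly F} := \sum_(m <- msupp p) p@_m *: 'X^(code m).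
have lt_b m i : m \in msupp p -> (m i < b)%N.
  move/msize_mdeg_lt/ltnW => le_m; rewrite ltnS; apply: leq_trans le_m.
  by rewrite mdegE (bigD1 i) //= leq_addr.
have /(poly_nonroot iota)[t Pt] : P != 0.
  have [m m_p] : exists m, m \in msupp p.
    by exists (mlead p); apply: mlead_supp.
  apply/eqP => /(congr1 (fun q : {poly F} => q`_(code m)))/eqP.
  rewrite coef0 coef_sum (bigD1_seq m) //= big1_seq.
    by rewrite addr0 coefZ coefXn eqxx mulr1 mcoeff_eq0 m_p.
  move=> m' /andP[ne_m m'_p]; rewrite coefZ coefXn.
  case: eqP => [eq_code|_]; last by rewrite mulr0.
  case/eqP: ne_m; apply/mnmP => i.
  by apply: (@base_expansion_inj N b) => // j; apply: lt_b.
exists (fun i => t ^+ (b ^ i)%N); apply: contraNneq Pt => <-.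
apply/eqP; rewrite mevalE /P horner_sum; apply: eq_bigr => m _.
rewrite hornerZ hornerXn -prodrXr; congr (_ * _); apply: eq_bigr => i _.
by rewrite rmorphXn -exprM mulnC.
Qed.

(** * Toric vector bundles *)

HB.instance Definition _ (F : fieldType) (n : nat) :=
  GRing.RMorphism.copy (@cst F n) (@FracField.tofrac _ \o @mpolyC n F).

Lemma character0 (K : fieldType) (n : nat) : character K (0 : 'rV_n) = 1.
Proof.
by rewrite /character /monomial_at big1 // => i _; rewrite mxE expr0z.
Qed.

Lemma characterD (K : fieldType) (n : nat) (m m' : 'rV_n) :
  character K (m + m') = character K m * character K m'.
Proof.
rewrite /character /monomial_at -big_split /=; apply: eq_bigr => i _.
by rewrite mxE expfzDr // /of_mpoly tofrac_eq0 -msupp_eq0 msuppX.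
Qed.

Lemma cone_ring_term (K : fieldType) (n : nat) (s : cone_data n) c m :
  in_dual s m -> cone_ring K s (cst n c * character K m).
Proof.
by move=> sm; exists 1%N, (fun=> c), (fun=> m); split=> //; rewrite big_ord1.
Qed.

Lemma cone_ring_cst (K : fieldType) (n : nat) (s : cone_data n) c :
  cone_ring K s (cst n c).
Proof.
rewrite -[cst n c]mulr1 -character0; apply: cone_ring_term => u _.
by rewrite /dot big1 // => i _; rewrite mxE mul0r.
Qed.

Lemma cone_ringD (K : fieldType) (n : nat) (s : cone_data n) f g :
  cone_ring K s f -> cone_ring K s g -> cone_ring K s (f + g).
Proof.
move=> [q [c [m [sm ->]]]] [q' [c' [m' [sm' ->]]]].
exists (q + q')%N,
  (fun j => match split j with inl i => c i | inr i => c' i end),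
  (fun j => match split j with inl i => m i | inr i => m' i end); split.
  by move=> j; case: split.
rewrite big_split_ord; congr (_ + _); apply: eq_bigr => i _.
  by rewrite -[lshift _ _]/(unsplit (inl i)) unsplitK.
by rewrite -[rshift _ _]/(unsplit (inr i)) unsplitK.
Qed.

Lemma cone_ring_semiring (K : fieldType) (n : nat) (s : cone_data n) :
  semiring_pred (cone_ring K s).
Proof.
have A0 : cone_ring K s 0 by rewrite -(rmorph0 (cst n)); apply: cone_ring_cst.
split=> //; last 1 first.
- move=> f g [q [c [m [sm ->]]]] [q' [c' [m' [sm' ->]]]].
  rewrite big_distrlr /=.
  apply: big_ind => // [x y|i _]; first exact: cone_ringD.
  apply: big_ind => // [x y|j _]; first exact: cone_ringD.
  rewrite mulrACA -rmorphM -characterD; apply: cone_ring_term => u su.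
  rewrite /dot; under eq_bigr do rewrite mxE mulrDl.
  by rewrite big_split addr_ge0 //; [apply: sm | apply: sm'].
- by rewrite -(rmorph1 (cst n)); apply: cone_ring_cst.
- by move=> f g; apply: cone_ringD.
Qed.

(** This is the ultrametric inequality and multiplicativity of valuations. The value of a valuation
    at 0 is a dummy, hence the separate treatment of vanishing elements. *)
Lemma OD_submodule (Y : model) (D : divisor Y) (A : ffield Y -> Prop) :
  submodule A (OD D A : (ffield Y)^o -> Prop).
Proof.
split; first by left.
- move=> u v [->|Hu] Hv; first by rewrite add0r.
  case: Hv => [->|Hv]; first by rewrite addr0; right.
  have [->|u0] := eqVneq u 0; first by rewrite add0r; right.
  have [->|v0] := eqVneq v 0; first by rewrite addr0; right.
  have [->|uv0] := eqVneq (u + v) 0; first by left.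
  right=> w Dw; have [dw _ _] := Dw.
  have [le_w|le_w] := orP (val_add dw u0 v0 uv0).
    by apply: le_trans (Hu w Dw) _; rewrite lerD2r.
  by apply: le_trans (Hv w Dw) _; rewrite lerD2r.
- move=> a u Aa [->|Hu]; first by left; rewrite scaler0.
  have [->|a0] := eqVneq a 0; first by left; rewrite scale0r.
  have [->|u0] := eqVneq u 0; first by left; rewrite scaler0.
  right=> w Dw; have [dw Aw _] := Dw.
  by rewrite [w _](val_mul dw a0 u0) -addrA addr_ge0 ?Aw ?Hu.
Qed.

Lemma vector_bundle_submodule (K : fieldType) (n : nat) (Sigma : fan_data n)
    (r : nat) (E : sheaf K n r) s :
  is_vector_bundle Sigma E -> s \in Sigma -> submodule (cone_ring K s) (E s).
Proof.
move=> vbE sS; split; first exact: vb_0 vbE _ sS.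
- by move=> u v; apply: vb_add vbE _ _ _ sS.
- by move=> a u; apply: vb_scale vbE _ _ _ sS.
Qed.

Lemma mulmx_id_eq1 (R : pzRingType) (q : nat) (M : 'M[R]_q) :
  (forall u : 'rV_q, u *m M = u) -> M = 1%:M.
Proof.
by move=> idM; apply/row_matrixP => i; rewrite -[M]mul1mx row_mul idM.
Qed.

(** The basis of E (x) K^l consists of the matrices with one row of g placed, transposed, in one
    column. Thus G is the matrix of M |-> g^T M on vectorized matrices, and its inverse is that of M
    |-> (g^-1)^T M. *)
Lemma tensor_triv_frame (K : fieldType) (n r : nat) (E : sheaf K n r) l s h g :
  submodule (cone_ring K s) (E s) -> is_frame E s h g ->
  exists G, local_frame (cone_ring K s) (tensor_triv E l s) h G.
Proof.
move=> [E0 ED EZ] [Ah h0 ug fr].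
have [A0 A1 _ _] := cone_ring_semiring K s.
have lin_mul (M : 'M[ratfun K n]_r) : exists G : 'M[ratfun K n]_(r * l),
    forall u, u *m G = mxvec (M *m vec_mx u).
  by exists (lin_mulmx M) => u; rewrite -{1}[u]vec_mxK mul_vec_lin.
have [G GE] := lin_mul g^T; have [G' G'E] := lin_mul (invmx g)^T.
have GG' : G *m G' = 1%:M.
  apply: mulmx_id_eq1 => u; rewrite mulmxA GE G'E mxvecK mulmxA -trmx_mul.
  by rewrite mulmxV // trmx1 mul1mx vec_mxK.
have [uG _] := mulmx1_unit GG'.
have invG : invmx G = G' by rewrite -[G']mul1mx -(mulVmx uG) -mulmxA GG' mulmx1.
exists G; split=> // [v Ev k|k].
  rewrite invG G'E; case/mxvec_indexP: k => i a; rewrite mxvecE.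
  have /fr[w Aw] : exists N, E s (h ^+ N *: (col a (vec_mx v))^T).
    by exists 0%N; rewrite scale1r.
  move=> def_v; have def_w : (col a (vec_mx v))^T *m invmx g = w.
    by rewrite def_v (mulmxK ug).
  move: (Aw i); rewrite -def_w; congr (away _ _ _).
  rewrite !mxE; apply: eq_bigr => j _; rewrite !mxE.
  exact: mulrC.
case/mxvec_indexP: k => i a.
have [|N EN] := (fr (row i g)).2.
  exists (delta_mx 0 i); last by rewrite rowE.
  move=> j; exists 0%N; rewrite mul1r mxE.
  by case: andb.
exists N => b; rewrite rowE GE vec_mx_delta linearZ /= mxvecK.
(* The basis element of index (i, a) has the i-th row of g as its a-th column and zero in the
   others. *)
have -> : (col b (h ^+ N *: (g^T *m delta_mx i a)))^T
          = if a == b then h ^+ N *: row i g else 0.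
  apply/rowP => j; rewrite !mxE (bigD1 i) //= big1 => [|k ne_ki].
    rewrite !mxE eqxx eq_sym addr0; case: eqP => _; rewrite !mxE ?mulr1 //.
    by rewrite mulr0 mulr0.
  by rewrite !mxE (negbTE ne_ki) mulr0.
by case: ifP.
Qed.

(* H^0(P(E (x) K^l), pi^*O(D) (x) O(k)) = H^0(X, Sym^k(E (x) K^l) (x) O(D)) *)
Lemma H0_projE (K : fieldType) (n : nat) (Sigma : fan_data n) (r : nat)
    (E : sheaf K n r) (D : divisor (toric_variety K Sigma)) k l x :
  (exists s, s \in Sigma) -> is_vector_bundle Sigma E -> (0 < r * l)%N ->
  H0_proj (tensor_triv E l) D k x <->
  exists2 P, x = of_mpoly P &
    forall s, s \in Sigma -> sym_twist (tensor_triv E l) D k s P.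
Proof.
move=> [s0 s0S] vbE rl0; split; last first.
  move=> [P -> SP] s w sS _ _; exists 0%N, P.
  rewrite addn0; split; first exact: SP.
  by rewrite expr0 /of_mpoly tofrac1 mulr1.
move=> Hx.
have Hs s : s \in Sigma ->
    proj_section (OD D (cone_ring K s)) (tensor_triv E l s) k x.
  by move=> sS w; apply: Hx.
have sA (s : cone_data n) := cone_ring_semiring K s.
have sL s := OD_submodule D (cone_ring K s).
have frames s : s \in Sigma -> exists (q : nat) (a h : 'I_q -> ratfun K n),
    [/\ forall j, cone_ring K s (a j), \sum_j a j * h j = 1 &
        forall j, exists G,
          local_frame (cone_ring K s) (tensor_triv E l s) (h j) G].
  move=> sS; have [q [a [h [Aa ah1 fr]]]] := vb_locally_free vbE sS.
  exists q, a, h; split=> // j; have [g frg] := fr j.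
  exact: tensor_triv_frame (vector_bundle_submodule vbE sS) frg.
have [P xP] : exists P, x = of_mpoly P.
  (* Being a polynomial is a property of x in the function field, so a single frame over a single
     chart decides it. The cover has a member since the empty sum is not 1. *)
  have [q [a [h [_ ah1 fr]]]] := frames _ s0S.
  case: q a h ah1 fr => [|q] a h ah1 fr.
    by move: ah1; rewrite big_ord0 => /esym/eqP; rewrite oner_eq0.
  have [G frG] := fr ord0.
  exact: proj_section_poly rl0 (sA s0) (sL s0) frG (Hs _ s0S).
(* Over each chart, P is a section after localization at every h_j, and the partition of unity
   glues. *)
exists P => // s sS; have [q [a [h [Aa ah1 fr]]]] := frames _ sS.
have Ah j : cone_ring K s (h j) by have [G []] := fr j.
apply: (submodule_glue (sA s) (span_over_submodule _ (sL s)) Aa Ah ah1) => j.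
have [G frG] := fr j; apply: (proj_section_away rl0 (sA s) (sL s) frG).
by rewrite -xP; apply: Hs.
Qed.

(** * Maps induced by linear maps of V, and comparison of effective classes *)

Lemma sym_twist_subst (K : fieldType) (n : nat) (Sigma : fan_data n)
    (N N' : nat) (B : sheaf K n N) (B' : sheaf K n N')
    (D : divisor (toric_variety K Sigma)) k s (M : 'M_(N, N')) p :
  (forall v, B s v -> B' s (v *m M)) ->
  sym_twist B D k s p -> sym_twist B' D k s (linear_subst M p).
Proof.
move=> BM.
have [S0 SD _] := span_over_submodule (sym_prod (B' s) k)
  (OD_submodule D (cone_ring K s)).
move: p; apply: span_over_sub => [|p q Sp Sq|a _ La [w Bw ->]].
- by rewrite raddf0.
- by rewrite raddfD; exact: SD Sp Sq.
- rewrite linearZ rmorph_prod /=; apply: span_over_base => //.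
  exists (fun j => w j *m M) => [j|]; first exact: BM.
  by apply: eq_bigr => j _; rewrite linear_subst_form.
Qed.

(** The new columns are combinations of the old ones with coefficients in K, and constants are
    regular on every chart. *)
Lemma tensor_triv_map (K : fieldType) (n r : nat) (E : sheaf K n r) l l' s
    (phi : 'M[K]_(l, l')) v :
  submodule (cone_ring K s) (E s) -> tensor_triv E l s v ->
  tensor_triv E l' s (v *m lin_mulmxr (map_mx (cst n) phi)).
Proof.
move=> sE Ev b; rewrite -{1}[v]vec_mxK mul_vec_lin mxvecK.
have -> : (col b (vec_mx v *m map_mx (cst n) phi))^T
          = \sum_a cst n (phi a b) *: (col a (vec_mx v))^T.
  apply/rowP => i; rewrite !mxE summxE; apply: eq_bigr => a _.
  by rewrite !mxE mulrC.
apply: (submodule_sum sE) => a _ _; have [_ _ EZ] := sE.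
by apply: EZ; [apply: cone_ring_cst | apply: Ev].
Qed.

(** Both sides are Kronecker products with the identity of size r. The transpose enters when passing
    from the action on sections to the action on points. *)
Lemma lin_mulmxr_tr (R : comNzRingType) (r l l' : nat) (phi : 'M[R]_(l, l')) :
  (lin_mulmxr phi : 'M_(r * l, r * l'))^T = lin_mulmxr phi^T.
Proof.
have entry p q (psi : 'M[R]_(p, q)) (i j : 'I_r) a b :
    lin_mulmxr psi (mxvec_index i a) (mxvec_index j b) = (i == j)%:R * psi a b.
  rewrite !mxE /= vec_mx_delta mxvecE mxE (bigD1 a) //=.
  rewrite big1 => [|c /negbTE ne_ca]; rewrite !mxE ?ne_ca ?andbF ?mul0r //.
  by rewrite !eqxx andbT addr0 eq_sym.
apply/matrixP => j i; case/mxvec_indexP: j => j b; case/mxvec_indexP: i => i a.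
by rewrite mxE !entry mxE eq_sym.
Qed.

(** The factorization hypothesis lets a point Y where the section P does not vanish be reached as
    the image of a point Z for K^l', so that the pullback of P is nonzero at Z. *)
Lemma effective_class_factor (K : closedFieldType) (n : nat)
    (Sigma : fan_data n) (r : nat) (E : sheaf K n r) (m : nat)
    (b : 'I_m -> divisor (toric_variety K Sigma)) (l l' : nat) x :
  (exists s, s \in Sigma) -> is_vector_bundle Sigma E ->
  (0 < r * l)%N -> (0 < r * l')%N ->
  (forall Y : 'M[K]_(r, l),
     exists (Z : 'M_(r, l')) (phi : 'M_(l', l)), Y = Z *m phi) ->
  effective_class E b l x -> effective_class E b l' x.
Proof.
move=> neS vbE rl0 rl'0 factor [a [k [-> [g g0 Hg]]]]; exists a, k; split=> //.
have [P gP SP] := (H0_projE _ _ _ neS vbE rl0).1 Hg.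
have P0 : P != 0 by apply: contraNneq g0 => P0; rewrite gP P0 /of_mpoly tofrac0.
have [x0 Px0] := mpoly_nonroot (@cst K n) P0.
have [Z [phi def_Y]] := factor (vec_mx (\row_i x0 i)).
(* Sections are multiplied by phi^T on the right, so that on points the dual map is Z |-> Z phi; it
   sends the chosen Z to Y. *)
pose M := lin_mulmxr (map_mx (@cst K n) phi^T) : 'M_(r * l, r * l').
exists (of_mpoly (linear_subst M P)); last first.
  apply/(H0_projE _ _ _ neS vbE rl'0); exists (linear_subst M P) => // s sS.
  apply: sym_twist_subst (SP s sS) => v.
  exact: tensor_triv_map (vector_bundle_submodule vbE sS).
rewrite /of_mpoly tofrac_eq0; apply: contraNneq Px0 => MP0.
pose z := (mxvec (map_mx (@cst K n) Z))^T.
have Mz i : (M *m z) i 0 = cst n (x0 i).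
  rewrite -[M]trmxK -trmx_mul lin_mulmxr_tr -map_trmx trmxK mul_vec_lin /=.
  by rewrite -map_mxM -def_Y mxE -map_mxvec vec_mxK !mxE.
rewrite -(meval_eq _ Mz) -linear_subst_meval MP0.
by rewrite meval0.
Qed.

Lemma pseudo_effective_mono (K : fieldType) (n : nat) (Sigma : fan_data n)
    (r : nat) (E : sheaf K n r) (m : nat)
    (b : 'I_m -> divisor (toric_variety K Sigma)) (l l' : nat) :
  (forall x, effective_class E b l x -> effective_class E b l' x) ->
  forall x, pseudo_effective E b l x -> pseudo_effective E b l' x.
Proof.
move=> sub x Cx eps eps0; have [y [Sy y1 y2]] := Cx eps eps0.
exists y; split; [exact: span_over_mono Sy|exact: y1|exact: y2].
Qed.

Theorem corollary1p9 (K : closedFieldType) (n : nat) (Sigma : fan_data n)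
    (fanSigma : is_fan Sigma)
    (smoothX : smooth n (toric_variety K Sigma))
    (projectiveX : projective (toric_variety K Sigma))
    (r : nat) (r_gt0 : (0 < r)%N)
    (E : toric_bundle K Sigma r)
    (mdsFL : mori_dream_space (flag_bundle Sigma E))
    (m : nat) (b : 'I_m -> divisor (toric_variety K Sigma))
    (basis_b : class_basis b) :
  (forall i j : nat, (0 < i)%N -> (i < j)%N ->
     forall x, pseudo_effective E b i x -> pseudo_effective E b j x) /\
  (forall l : nat, (r <= l)%N ->
     forall x, pseudo_effective E b l x <-> pseudo_effective E b r x).
Proof.
have neS := fan_nonempty fanSigma; have vbE := sections_vb E.
(* The weak inequality i <= j lets this serve for l = r in the second claim too. *)
have widen i j : (0 < i)%N -> (i <= j)%N ->
    forall x, pseudo_effective E b i x -> pseudo_effective E b j x.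
  move=> i0 le_ij; apply: pseudo_effective_mono => x.
  apply: effective_class_factor => //; rewrite ?muln_gt0 ?r_gt0 ?i0 //.
    exact: leq_trans le_ij.
  (* Z is Y padded with zero columns, and phi projects onto the first i coordinates. *)
  move=> Y; exists (Y *m pid_mx i), (pid_mx i).
  by rewrite -mulmxA pid_mx_id // pid_mx_1 mulmx1.
split=> [i j i0 /ltnW|l le_rl x]; first exact: widen.
split; last exact: widen.
have l0 := leq_trans r_gt0 le_rl.
apply: pseudo_effective_mono x => x.
apply: effective_class_factor => //; rewrite ?muln_gt0 ?r_gt0 ?l0 //.
(* For l' = r the identity is an admissible point Z, and Y itself serves as the linear map. *)
by move=> Y; exists 1%:M, Y; rewrite mul1mx.
Qed.
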